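(* Let $P\subset\mathbb{R}^n$ be a polytope with non-empty interior. Let $f:P\to\mathbb{R}$ be a continuously differentiable and ray-concave function over $P$ such that $f$ is convex over the facets of $P$. Let $g:P\to\mathbb{R}$ be defined by $$g(v)=\alpha_v f(v^-)+(1-\alpha_v) f(v^+),$$ where $\alpha_v\in[0,1]$ is such that $v=\alpha_v v^-+(1-\alpha_v)v^+$ (and $g(0)=f(0)$ if $0\in P$). If $g$ is positively homogeneous, then $f_{\text{vex}}=g$ on $P$.
   Context: Ray-concave: $f:P\to\mathbb{R}$ is ray-concave over $P$ if, for every $x\in P$, the restriction of $f$ to $\{\alpha x:\alpha\ge 0\}\cap P$ is concave. Convex over the facets: the restriction of $f$ to each facet of $P$ is convex. For $v\in\mathbb{R}^n\setminus\{0\}$ such that $\alpha v\in P$ for some $\alpha\ge 0$, set $v^+=\alpha^+v$ with $\alpha^+=\max\{\alpha\ge 0:\alpha v\in P\}$ and $v^-=\alpha^-v$ with $\alpha^-=\min\{\alpha\ge 0:\alpha v\in P\}$. (If $0\in P$ then $v^-=0$.) When $v^-=v^+$ the value of $g(v)$ does not depend on the choice of $\alpha_v$. Positively homogeneous: $g(\lambda v)=\lambda g(v)$ for all $v\in P$ and $\lambda>0$ with $\lambda v\in P$. Convex envelope of $f$ over $P$: $f_{\text{vex}}(x)=\sup\{h(x): h \text{ is convex on } P \text{ and } h(y)\le f(y)\ \forall y\in P\}$ for $x\in P$.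
   Formalization: The case n = 1 with 0 in the interior of P is excluded, since the claim fails there: for P = [-1,1] and f(x) = -x^2, g(v) = -|v| is positively homogeneous but f_vex = -1 on P. *)

(* Defs.v *)
From mathcomp Require Import all_boot all_order all_algebra.
From mathcomp Require Import all_classical all_reals all_analysis.

Set Implicit Arguments.
Unset Strict Implicit.
Unset Printing Implicit Defensive.

Import Order.TTheory GRing.Theory Num.Theory.
Import numFieldNormedType.Exports.

Local Open Scope classical_set_scope.
Local Open Scope ring_scope.

(* Functions on P are represented by total functions on 'rV[R]_n; no notion
   below depends on the values taken outside of P. *)

Definition dotv (R : realType) (n : nat) (u v : 'rV[R]_n) : R :=
  \sum_(i < n) u 0 i * v 0 i.

(* A polytope is a bounded intersection of finitely many closed halfspaces. *)
Definition polytope (R : realType) (n : nat) (P : set 'rV[R]_n) : Prop :=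
  bounded_set P /\
  exists (m : nat) (a : 'I_m -> 'rV[R]_n) (b : 'I_m -> R),
    P = [set x | forall i, dotv (a i) x <= b i].

(* The affine hull of F is x0 plus the row space of a rank-k matrix. *)
Definition affdim (R : realType) (n : nat) (F : set 'rV[R]_n) (k : nat) : Prop :=
  exists (x0 : 'rV[R]_n) (B : 'M[R]_(k, n)),
    [/\ row_free B, F x0, forall i, F (x0 + row i B)
      & forall y, F y -> (y - x0 <= B)%MS].

Definition face (R : realType) (n : nat) (P F : set 'rV[R]_n) : Prop :=
  exists (a : 'rV[R]_n) (b : R),
    (forall x, P x -> dotv a x <= b) /\ F = P `&` [set x | dotv a x = b].

Definition facet (R : realType) (n : nat) (P F : set 'rV[R]_n) : Prop :=
  face P F /\ exists k, affdim P k.+1 /\ affdim F k.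

(* f is differentiable at every point of P relative to P, boundary points
   included, with a gradient that is continuous on P. *)
Definition continuously_differentiable_on (R : realType) (n : nat)
    (P : set 'rV[R]_n) (f : 'rV[R]_n -> R) : Prop :=
  exists grad : 'rV[R]_n -> 'rV[R]_n,
    {within P, continuous grad} /\
    forall x, P x -> forall e : R, 0 < e ->
      \forall y \near within P (nbhs x),
        `|f y - f x - dotv (grad x) (y - x)| <= e * `|y - x|.

Definition concave_function (R : realType) (n : nat)
    (D : set 'rV[R]_n) (f : 'rV[R]_n -> R) : Prop :=
  convex_function D (fun x => - f x).

Definition ray (R : realType) (n : nat) (x : 'rV[R]_n) : set 'rV[R]_n :=
  [set a *: x | a in [set a : R | 0 <= a]].

Definition ray_concave (R : realType) (n : nat)
    (P : set 'rV[R]_n) (f : 'rV[R]_n -> R) : Prop :=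
  forall x, P x -> concave_function (ray x `&` P) f.

Definition convex_over_facets (R : realType) (n : nat)
    (P : set 'rV[R]_n) (f : 'rV[R]_n -> R) : Prop :=
  forall F, facet P F -> convex_function F f.

(* The default 0 is returned only when A has no greatest (resp. least)
   element. *)
Definition set_max (R : realType) (A : set R) : R := xget 0 (A `&` ubound A).
Definition set_min (R : realType) (A : set R) : R := xget 0 (A `&` lbound A).

Definition ray_coefs (R : realType) (n : nat)
    (P : set 'rV[R]_n) (v : 'rV[R]_n) : set R :=
  [set a | 0 <= a /\ P (a *: v)].

Definition vplus (R : realType) (n : nat)
    (P : set 'rV[R]_n) (v : 'rV[R]_n) : 'rV[R]_n :=
  set_max (ray_coefs P v) *: v.

Definition vminus (R : realType) (n : nat)
    (P : set 'rV[R]_n) (v : 'rV[R]_n) : 'rV[R]_n :=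
  set_min (ray_coefs P v) *: v.

(* Some weight writing v as a convex combination of its two ray endpoints;
   one exists for every nonzero v in a compact convex P, and it is unique
   unless the endpoints coincide. *)
Definition ray_weight (R : realType) (n : nat)
    (P : set 'rV[R]_n) (v : 'rV[R]_n) : R :=
  xget 0 [set a : R | 0 <= a <= 1 /\
                      v = a *: vminus P v + (1 - a) *: vplus P v].

Definition ray_interpolation (R : realType) (n : nat)
    (P : set 'rV[R]_n) (f : 'rV[R]_n -> R) (v : 'rV[R]_n) : R :=
  if v == 0 then f 0
  else ray_weight P v * f (vminus P v) + (1 - ray_weight P v) * f (vplus P v).

Definition positively_homogeneous (R : realType) (n : nat)
    (P : set 'rV[R]_n) (g : 'rV[R]_n -> R) : Prop :=
  forall v (l : R), P v -> 0 < l -> P (l *: v) -> g (l *: v) = l * g v.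

(* The supremum is taken in the extended reals, so that no default value of
   the real supremum is involved. *)
Definition convex_envelope (R : realType) (n : nat)
    (P : set 'rV[R]_n) (f : 'rV[R]_n -> R) (x : 'rV[R]_n) : \bar R :=
  ereal_sup [set (h x)%:E | h in
    [set h : 'rV[R]_n -> R |
      convex_function P h /\ forall y, P y -> h y <= f y]].

(* Main.v *)
Require Import Defs.
From mathcomp Require Import all_boot all_order all_algebra.
From mathcomp Require Import all_classical all_reals all_analysis.
From mathcomp Require Import ring lra.

Import Order.TTheory GRing.Theory Num.Theory.
Import numFieldNormedType.Exports.

Local Open Scope classical_set_scope.
Local Open Scope ring_scope.

(** Write g for the ray interpolation of f.  Ray-concavity gives g <= f, and
    every convex minorant of f lies below g, because g(v) is an average of the
    values of f at two points of P whose average is v.  So f_vex = g as soon as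
    g is convex, and that is what the proof is about.

    Describe P by an irredundant system a_i . x <= b_i, so that every inequality
    defines a facet.  With gauge v := max (0, max over b_i > 0 of a_i . v / b_i),
    the upper endpoint of the ray through v is v^+ = v / gauge v, and positive
    homogeneity turns g into g(v) = gauge v * f (v / gauge v): g is the
    homogeneous extension of the restriction of f to the part of the boundary
    that faces away from the origin.  On the cone over one facet this is the
    perspective of a convex function, hence convex.  The point is that the
    pieces fit together convexly across the ridges.

    At w = v^+, with a facet a . x = b > 0 through w, the candidate for a
    supporting functional is the linear form
      u(y) = grad f(w) . y + (f(w) - grad f(w) . w) * (a . y / b).
    It takes the value g(w) at w.  Its second coefficient is nonnegative: f lies
    above g on the ray, g is linear there and agrees with f at w, so the radial
    derivative of f at w is at most f(w) (radial_derivative_le).  Therefore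
    replacing a . y / b by its bound 1 only increases u, so u stays below the
    tangent of f at w on every facet through w, and below f by convexity of f
    on that facet (facet_tangent_le).  Since the facets met near w all contain
    w, u supports g near v (g_local_support).

    A continuous function on a segment with an affine local support at each
    interior point is convex (convex_of_local_support).  This settles all
    segments inside the interior of P that avoid the origin.  The remaining
    ones are limits of those (convex_between_limit): if the origin lies strictly
    between x and y, tilt y slightly, which is possible because the dimension is
    then at least 2; for boundary points, shrink the segment towards an interior
    point. *)

Set Implicit Arguments.
Unset Strict Implicit.
Unset Printing Implicit Defensive.

(** * Dot products and convexity along segments *)

Section Dot.
Variables (R : realType) (n : nat).
Implicit Types a x y : 'rV[R]_n.

Lemma dotvDr a x y : dotv a (x + y) = dotv a x + dotv a y.
Proof. by rewrite /dotv -big_split; apply: eq_bigr => i _; rewrite mxE mulrDr. Qed.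

Lemma dotvDl a b x : dotv (a + b) x = dotv a x + dotv b x.
Proof. by rewrite /dotv -big_split; apply: eq_bigr => i _; rewrite mxE mulrDl. Qed.

Lemma dotvZl a x c : dotv (c *: a) x = c * dotv a x.
Proof. by rewrite /dotv mulr_sumr; apply: eq_bigr => i _; rewrite mxE mulrA. Qed.

Lemma dotvZr a x c : dotv a (c *: x) = c * dotv a x.
Proof. by rewrite /dotv mulr_sumr; apply: eq_bigr => i _; rewrite mxE mulrCA. Qed.

Lemma dotvBr a x y : dotv a (x - y) = dotv a x - dotv a y.
Proof. by rewrite dotvDr -scaleN1r dotvZr mulN1r. Qed.

Lemma dotv0r a : dotv a 0 = 0.
Proof. by rewrite -(scale0r 0) dotvZr mul0r. Qed.

Lemma dotv_mulmx a x : dotv a x = (x *m a^T) 0 0.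
Proof. by rewrite /dotv mxE; apply: eq_bigr => i _; rewrite mxE mulrC. Qed.

Lemma dotv_continuous a : continuous (dotv a).
Proof.
have addc : continuous (fun z : R * R => z.1 + z.2) by exact: add_continuous.
move=> x; apply: (@cvg_big R _ +%R 0 xpredT addc _ (nbhs x) _ _ _ (nbhs_filter x)) => i _.
by apply: cvgM; [exact: cvg_cst|exact: coord_continuous].
Qed.

End Dot.

Lemma convex_functionP (R : realType) (n : nat) (D : set 'rV[R]_n)
    (f : 'rV[R]_n -> R) :
  convex_function D f <->
  forall x y t, D x -> D y -> 0 <= t <= 1 ->
    f (t *: x + (1 - t) *: y) <= t * f x + (1 - t) * f y.
Proof.
split=> [cf x y t Dx Dy t01|cf t x y /set_mem Dx /set_mem Dy].
  have := cf (Itv01 (andP t01).1 (andP t01).2) x y (mem_set Dx) (mem_set Dy).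
  by [].
apply: (cf _ _ t%:num) => //.
by rewrite ge0 le1.
Qed.

Lemma le_of_le_addM (R : realType) (x y C : R) : 0 <= C ->
  (forall e, 0 < e -> x <= y + e * C) -> x <= y.
Proof.
move=> C0 H; apply/ler_addgt0Pr => e e0.
have C1 : 0 < C + 1 by rewrite ltr_pwDr.
apply: (le_trans (H (e / (C + 1)) _)); first by rewrite divr_gt0.
rewrite lerD2l -mulrA ger_pMr // mulrC ler_pdivrMr // mul1r.
by rewrite lerDl.
Qed.

Lemma lerp_line (R : realType) (V : lmodType R) (x y : V) (t : R) :
  t *: x + (1 - t) *: y = y + t *: (x - y).
Proof. by rewrite scalerBl scale1r scalerBr addrCA. Qed.

Lemma line_cvg (R : realType) (V : normedModType R) (x d : V) (t : R) :
  x + s *: d @[s --> t] --> x + t *: d.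
Proof.
apply: cvgD; first exact: cvg_cst.
by apply: cvgZ; [exact: cvg_id|exact: cvg_cst].
Qed.

Lemma near_line (R : realType) (V : normedModType R) (Q : V -> Prop) (x d : V) :
  (\forall y \near x, Q y) -> \forall t \near (0 : R), Q (x + t *: d).
Proof.
by move=> nQ; have := @line_cvg R V x d 0; rewrite scale0r addr0 => /(_ _ nQ).
Qed.

Lemma near0_exists_pos (R : realType) (Q : R -> Prop) :
  (\forall t \near (0 : R), Q t) -> exists t, 0 < t < 1 /\ Q t.
Proof.
move=> nQ.
have : \forall t \near (0 : R)^'+, 0 < t < 1 /\ Q t.
  near=> t; split.
    by apply/andP; split; near: t; [exact: nbhs_right_gt|exact: nbhs_right_lt].
  by near: t; exact: (cvg_within _ nQ).
by move=> /filter_ex.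
Unshelve. all: by end_near. Qed.

(** * Polyhedra given by an irredundant system of inequalities *)

Section Halfspaces.
Variables (R : realType) (n : nat).

Definition halfspaces m (a : 'I_m -> 'rV[R]_n) (b : 'I_m -> R) : set 'rV[R]_n :=
  [set x | forall i, dotv (a i) x <= b i].

Definition strictly_inside m (a : 'I_m -> 'rV[R]_n) (b : 'I_m -> R) x :=
  forall i, dotv (a i) x < b i.

Lemma halfspaces_convex m (a : 'I_m -> 'rV[R]_n) b x y t :
  halfspaces a b x -> halfspaces a b y -> 0 <= t <= 1 ->
  halfspaces a b (t *: x + (1 - t) *: y).
Proof.
move=> Px Py /andP[t0 t1] i; rewrite dotvDr !dotvZr.
have := ler_wpM2l t0 (Px i).
have := @ler_wpM2l _ (1 - t) _ _ _ (Py i); rewrite subr_ge0 => /(_ t1).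
lra.
Qed.

Lemma halfspaces_closed m (a : 'I_m -> 'rV[R]_n) b : closed (halfspaces a b).
Proof.
have -> : halfspaces a b = \bigcap_i (dotv (a i) @^-1` [set x | x <= b i]).
  by apply/seteqP; split=> x /= Hx i; [move=> _|]; exact: Hx.
apply: closed_bigI => i _; apply: preimage_closed; last exact: closed_le.
by move=> x _; exact: dotv_continuous.
Qed.

Lemma strictly_inside_combination m (a : 'I_m -> 'rV[R]_n) b x y t :
  strictly_inside a b x -> halfspaces a b y -> 0 < t <= 1 ->
  strictly_inside a b (t *: x + (1 - t) *: y).
Proof.
move=> sx Py /andP[t0 t1] i; rewrite dotvDr !dotvZr.
have := sx i; rewrite -(ltr_pM2l t0) => lt1.
have := @ler_wpM2l _ (1 - t) _ _ _ (Py i); rewrite subr_ge0 => /(_ t1).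
lra.
Qed.

Lemma strictly_insideW m (a : 'I_m -> 'rV[R]_n) b x :
  strictly_inside a b x -> halfspaces a b x.
Proof. by move=> sx i; exact: ltW. Qed.

Lemma strictly_inside_near m (a : 'I_m -> 'rV[R]_n) b x :
  strictly_inside a b x -> \forall y \near x, strictly_inside a b y.
Proof.
move=> sx.
suff H i : \forall y \near x, dotv (a i) y < b i.
  exact: (@filter_forall _ 'I_m (fun i y => dotv (a i) y < b i) (nbhs x) _ H).
by have /cvgr_lt /(_ _ (sx i)) := @dotv_continuous _ _ (a i) x.
Qed.

(** Moving from x in the direction u keeps all constraints valid for a while if
    each constraint is either slack at x or constant along u. *)
Lemma halfspaces_near m (a : 'I_m -> 'rV[R]_n) b x u :
  (forall i, dotv (a i) x < b i \/ dotv (a i) x <= b i /\ dotv (a i) u = 0) ->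
  \forall t \near (0 : R), halfspaces a b (x + t *: u).
Proof.
move=> H; rewrite /halfspaces /=.
suff nearH i : \forall t \near (0 : R), dotv (a i) (x + t *: u) <= b i.
  exact: (@filter_forall R 'I_m (fun i t => dotv (a i) (x + t *: u) <= b i)
    (nbhs 0) _ nearH).
have [lt|[le eq0]] := H i; last first.
  by near=> t; rewrite dotvDr dotvZr eq0 mulr0 addr0.
apply: (near_line (Q := fun y => dotv (a i) y <= b i)).
have := @dotv_continuous _ _ (a i) x => /cvgr_lt /(_ _ lt) near_lt.
by near=> y; apply: ltW; near: y.
Unshelve. all: by end_near. Qed.

(** Take a presentation with the least number of inequalities.  Dropping
    inequality i then enlarges P, so some x violates i alone; the segment from
    the interior point p to x crosses the hyperplane of i at a point q where all
    the other inequalities are strict. *)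
Lemma irredundant_halfspaces (P : set 'rV[R]_n) p :
  (exists m (a : 'I_m -> 'rV[R]_n) b, P = halfspaces a b) -> interior P p ->
  exists m (a : 'I_m -> 'rV[R]_n) b, [/\ P = halfspaces a b,
    strictly_inside a b p &
    forall i, exists q, dotv (a i) q = b i /\
      forall j, j != i -> dotv (a j) q < b j].
Proof.
move=> exm pint.
have exm' : exists m, `[< exists (a : 'I_m -> 'rV[R]_n) b, P = halfspaces a b >].
  by case: exm => m H; exists m; apply/asboolP.
case: (ex_minnP exm') => m /asboolP[a [b Pab]] minm.
exists m, a, b.
have Pp : P p by exact: interior_subset pint.
have viol i : exists x, b i < dotv (a i) x /\
    forall j, j != i -> dotv (a j) x <= b j.
  apply: contrapT => nex.
  case: m a b Pab minm i nex => [|m] a b Pab minm i nex; first by case: i nex.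
  suff : (m.+1 <= m)%N by rewrite ltnn.
  (* Without such an x, inequality i follows from the others and can be dropped. *)
  apply: minm; apply/asboolP; exists (a \o lift i), (b \o lift i).
  rewrite Pab; apply/seteqP; split=> x /= Hx => [j|j]; first exact: Hx.
  have [k ->|->] := unliftP i j; first exact: Hx.
  rewrite leNgt; apply/negP => lt; apply: nex; exists x; split => // k.
  by rewrite eq_sym => /unlift_some[l -> _]; exact: Hx.
have strict i : dotv (a i) p < b i.
  have [x [xi _]] := viol i.
  rewrite lt_neqAle; move: (Pp); rewrite Pab => /(_ i) ->; rewrite andbT.
  apply/eqP => pi.
  (* If i were tight at p, moving from p towards x would leave P at once. *)
  have [t [/andP[t0 _]]] := near0_exists_pos (near_line (x - p) pint).
  rewrite Pab => /(_ i); rewrite dotvDr dotvZr dotvBr pi.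
  by rewrite gerDl pmulr_rle0 // subr_le0 leNgt xi.
split=> // i.
have [x [xi xj]] := viol i.
pose D := dotv (a i) x - dotv (a i) p.
have D0 : 0 < D by rewrite subr_gt0 (lt_trans (strict i)).
pose t := (b i - dotv (a i) p) / D.
have t0 : 0 < t by rewrite divr_gt0 // subr_gt0.
have t1 : t < 1 by rewrite ltr_pdivrMr // mul1r ltrD2r.
exists (p + t *: (x - p)); split=> [|j ji]; rewrite dotvDr dotvZr dotvBr.
  by rewrite divfK ?gt_eqF // addrC subrK.
have := strict j; have := xj _ ji.
nra.
Qed.

End Halfspaces.

(** A neighbourhood of the origin is contained in a line only in dimension at
    most 1. *)
Lemma exists_inside_off_line (R : realType) (n m : nat)
    (a : 'I_m -> 'rV[R]_n) (b : 'I_m -> R) x :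
  (n = 1%N -> ~ interior (halfspaces a b) 0) ->
  x != 0 -> strictly_inside a b 0 ->
  exists q, strictly_inside a b q /\ forall c, q != c *: x.
Proof.
move=> n1 x0 s0.
have n0 := strictly_inside_near s0.
have nN1 : n <> 1%N.
  move=> /n1; apply; apply: filterS n0 => y sy i; exact: ltW.
have [i xi] : exists i, x 0 i != 0.
  by move/rV0Pn : x0.
have [j ji] : exists j : 'I_n, j != i.
  apply: contrapT => nex; apply: nN1.
  rewrite -(card_ord n); apply/eqP/fintype1P; exists i => j.
  by apply/eqP/negPn/negP => ji; apply: nex; exists j.
have [t [/andP[t0 _] st]] := near0_exists_pos (near_line (delta_mx 0 j) n0).
exists (t *: delta_mx 0 j); split; first by rewrite add0r in st.
move=> c; apply/eqP => /rowP cE.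
have := cE i; rewrite !mxE eqxx (negPf (_ : i != j)) 1?eq_sym // mulr0.
move=> /esym/eqP; rewrite mulf_eq0 (negPf xi) orbF => /eqP c0.
by have := cE j; rewrite !mxE !eqxx c0 mul0r mulr1 => /eqP; rewrite gt_eqF.
Qed.

(** * Facets *)

Section Facets.
Variables (R : realType) (n m : nat) (a : 'I_m -> 'rV[R]_n) (b : 'I_m -> R).

(** It suffices to move a little from x along each row of B: one common step
    length t serves all rows, and t *: B spans the same space as B. *)
Lemma affdim_of_near (F : set 'rV[R]_n) x k (B : 'M[R]_(k, n)) :
  F x -> row_free B ->
  (forall i, \forall t \near (0 : R), F (x + t *: row i B)) ->
  (forall y, F y -> (y - x <= B)%MS) -> affdim F k.
Proof.
move=> Fx freeB nearF subB.
have /near0_exists_pos[t [/andP[t0 _] Ft]] :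
    \forall t \near (0 : R), forall i, F (x + t *: row i B).
  exact: (@filter_forall R 'I_k (fun i t => F (x + t *: row i B)) (nbhs 0) _ nearF).
exists x, (t *: B); split=> //.
- by rewrite /row_free mxrank_scale_nz // gt_eqF.
- by move=> i; rewrite linearZ; exact: Ft.
- by move=> y Fy; rewrite eqmx_scale ?gt_eqF //; exact: subB.
Qed.

(** Near q only inequality i matters, so the face contains a neighbourhood of q
    in the hyperplane of a_i, whose directions form the kernel of a_i, of rank
    n - 1. *)
Lemma facet_of_halfspace p i q :
  strictly_inside a b p ->
  dotv (a i) q = b i -> (forall j, j != i -> dotv (a j) q < b j) ->
  facet (halfspaces a b) (halfspaces a b `&` [set x | dotv (a i) x = b i]).
Proof.
move=> pint qi qj; split.
  by exists (a i), (b i); split=> // x; apply.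
have aN0 : (a i)^T != 0.
  apply/eqP => /(congr1 trmx); rewrite trmxK trmx0 => a0.
  have := pint i; rewrite -qi a0 /dotv.
  by rewrite !big1 ?ltxx // => j _; rewrite mxE mul0r.
have Pq : halfspaces a b q.
  by move=> j; have [->|/qj/ltW] := eqVneq j i; rewrite ?qi.
pose K := kermx (a i)^T.
have rankK : (\rank K).+1 = n.
  have rank1 : \rank (a i)^T = 1%N.
    by apply/eqP; rewrite eqn_leq rank_leq_col lt0n mxrank_eq0.
  have n0 : (0 < n)%N by rewrite -rank1 rank_leq_row.
  by rewrite mxrank_ker rank1 subn1 prednK.
exists (\rank K); split.
  rewrite rankK; apply: (@affdim_of_near _ p _ 1%:M).
  - by move=> j; apply: ltW.
  - by rewrite row_free_unit unitmx1.
  - by move=> j; apply: halfspaces_near => k; left.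
  - by move=> y _; exact: submx1.
apply: (@affdim_of_near _ q _ (row_base K)) => //.
- exact: row_base_free.
- move=> j.
  have rowK : dotv (a i) (row j (row_base K)) = 0.
    rewrite dotv_mulmx.
    have : (row j (row_base K) <= K)%MS.
      by apply: (submx_trans (row_sub _ _)); rewrite eq_row_base.
    by move/sub_kermxP => ->; rewrite mxE.
  have nearP : \forall t \near (0 : R), halfspaces a b (q + t *: row j (row_base K)).
    apply: halfspaces_near => k; have [->|/qj] := eqVneq k i; last by left.
    by right; rewrite qi.
  near=> t; split; first by near: t.
  by rewrite /= dotvDr dotvZr rowK mulr0 addr0.
- move=> y [_ /= yi]; rewrite eq_row_base; apply/sub_kermxP.
  by apply/matrixP => r s; rewrite !ord1 -dotv_mulmx dotvBr yi qi subrr mxE.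
Unshelve. all: by end_near. Qed.

End Facets.

(** * The gauge of a polyhedron *)

Section Gauge.
Variables (R : realType) (n m : nat) (a : 'I_m -> 'rV[R]_n) (b : 'I_m -> R).

(** For v != 0 in a bounded P this is the reciprocal of the largest c with
    c *: v in P.  The inequalities with b_i <= 0 cannot block an outward move:
    a_i . v <= b_i <= 0 persists under scaling by c >= 1.  The default value 0
    makes the gauge nonnegative and is its value at the origin. *)
Definition gauge (v : 'rV[R]_n) : R :=
  \big[Num.max/0]_(i | 0 < b i) (dotv (a i) v / b i).

Lemma gauge_ge0 v : 0 <= gauge v.
Proof. exact: bigmax_ge_id. Qed.

Lemma dotv_le_gauge i v : 0 < b i -> dotv (a i) v <= gauge v * b i.
Proof.
by move=> bi; rewrite -ler_pdivrMr //; apply: (@le_bigmax_cond _ _ _ _ i (fun i => 0 < b i)).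
Qed.

Lemma gauge_attained v : 0 < gauge v ->
  exists2 i, 0 < b i & dotv (a i) v = gauge v * b i.
Proof.
move=> g0.
have [[i bi di]|nex] := pselect (exists2 i, 0 < b i & gauge v <= dotv (a i) v / b i).
  exists i => //; apply/eqP; rewrite eq_le dotv_le_gauge //=.
  by rewrite -ler_pdivlMr.
suff : gauge v < gauge v by rewrite ltxx.
rewrite {1}/gauge; apply: bigmax_lt => // i bi.
by rewrite ltNge; apply/negP => le; apply: nex; exists i.
Qed.

Lemma gaugeZ c v : 0 < c -> gauge (c *: v) = c * gauge v.
Proof.
move=> c0; rewrite /gauge.
pose F i := dotv (a i) v / b i.
have -> : c * \big[Num.max/0]_(i | 0 < b i) F i = \big[Num.max/0]_(i | 0 < b i) (c * F i).
  apply: (big_morph (fun x => c * x)) => [x y|]; last by rewrite mulr0.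
  by rewrite maxr_pMr // ltW.
by apply: eq_bigr => i _; rewrite /F dotvZr mulrA.
Qed.

Lemma gauge0 : gauge 0 = 0.
Proof.
by rewrite /gauge; elim/big_rec: _ => // i x _ ->; rewrite dotv0r mul0r maxxx.
Qed.

Lemma gauge_continuous : continuous gauge.
Proof.
have maxc : continuous (fun z : R * R => Num.max z.1 z.2).
  by move=> z; apply: continuous_max; [exact: cvg_fst|exact: cvg_snd].
move=> v; apply: (@cvg_big R _ Num.max 0 _ maxc _ (nbhs v) _ _ _ (nbhs_filter v)) => i _.
by apply: cvgM; [exact: dotv_continuous|exact: cvg_cst].
Qed.

Lemma gauge_le1 v : halfspaces a b v -> gauge v <= 1.
Proof.
by move=> Pv; apply: bigmax_le => // i bi; rewrite ler_pdivrMr // mul1r; exact: Pv.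
Qed.

Lemma gauge_lt1 x : strictly_inside a b x -> gauge x < 1.
Proof.
by move=> sx; apply: bigmax_lt => // i bi; rewrite ltr_pdivrMr // mul1r; exact: sx.
Qed.

Lemma halfspacesZ v c : halfspaces a b v -> 1 <= c -> c * gauge v <= 1 ->
  halfspaces a b (c *: v).
Proof.
move=> Pv c1 cg i; rewrite dotvZr.
have c0 : 0 <= c by apply: le_trans c1.
have [bi|bi] := ltP 0 (b i).
  apply: (@le_trans _ _ (c * (gauge v * b i))).
    by apply: ler_wpM2l => //; exact: dotv_le_gauge.
  by rewrite mulrA ler_piMl // ltW.
have := ler_wpM2l c0 (Pv i); nra.
Qed.

(** If the gauge vanished, the whole half-line from v outwards would stay in the
    polyhedron. *)
Lemma gauge_gt0 v : bounded_set (halfspaces a b) -> halfspaces a b v -> v != 0 ->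
  0 < gauge v.
Proof.
move=> bnd Pv v0; rewrite lt_def gauge_ge0 andbT; apply/eqP => g0.
have [M [Mreal HM]] := bnd.
have nv : 0 < `|v| by rewrite normr_gt0.
(* A factor that pushes v beyond the bound `|M| + 1 on the norm. *)
pose c := Num.max 1 ((`|M| + 2) / `|v|).
have : `|c *: v| <= `|M| + 1.
  apply: (HM (`|M| + 1)); first by rewrite (le_lt_trans (ler_norm M)) // ltrDl.
  by apply: halfspacesZ; rewrite // ?g0 ?mulr0 // /c le_max lexx.
have : `|M| + 2 <= `|c *: v|.
  rewrite normrZ -ler_pdivrMr // (le_trans _ (ler_norm _)) //.
  by rewrite /c le_max lexx orbT.
lra.
Qed.

End Gauge.

(** * From local supports to convexity on a segment *)

(** If phi exceeded its chord by e > 0 at some t, subtract from phi the chord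
    plus the concave parabola e * (s * (1 - s)).  The difference vanishes at 0
    and 1 and is still positive at t, so it has a positive maximum at an
    interior point c.  There phi lies above an affine function touching it, so
    the difference lies above a strictly convex parabola touching it at c, which
    contradicts maximality on one of the two sides of c. *)
Lemma convex_of_local_support (R : realType) (phi : R -> R) :
  {within `[0, 1], continuous phi} ->
  (forall t : R, 0 < t < 1 -> exists l : R,
     \forall s \near t, phi t + l * (s - t) <= phi s) ->
  forall t : R, 0 <= t <= 1 -> phi t <= t * phi 1 + (1 - t) * phi 0.
Proof.
move=> cphi supp t /andP[t0 t1]; rewrite leNgt; apply/negP => lt.
pose e := phi t - (t * phi 1 + (1 - t) * phi 0).
have e0 : 0 < e by rewrite subr_gt0.
pose chord s := s * phi 1 + (1 - s) * phi 0 + e * (s * (1 - s)).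
have cchord : continuous chord.
  move=> s; rewrite /chord; apply: cvgD; [apply: cvgD|]; apply: cvgM;
  do ?[exact: cvg_cst|exact: cvg_id|apply: cvgB; [exact: cvg_cst|exact: cvg_id]].
  by apply: cvgM; [exact: cvg_id|apply: cvgB; [exact: cvg_cst|exact: cvg_id]].
pose eta s := phi s - chord s.
have ceta : {within `[0, 1], continuous eta}.
  by apply: within_continuousB => //; exact: continuous_subspaceT.
have [c] := EVT_max ler01 ceta; rewrite in_itv /= => /andP[c0 c1] maxc.
have etac : 0 < eta c.
  apply: (lt_le_trans _ (maxc t _)); last by rewrite in_itv /= t0.
  rewrite /eta /chord opprD addrA -/e.
  have tt : t * (1 - t) < 1 by have := sqr_ge0 (2 * t - 1); rewrite expr2; nra.
  have : e * (t * (1 - t)) < e * 1 by rewrite ltr_pM2l.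
  lra.
have c01 : 0 < c < 1.
  rewrite !lt_neqAle c0 c1 !andbT; apply/andP; split; apply/eqP => cE.
    by move: etac; rewrite -cE /eta /chord; lra.
  by move: etac; rewrite cE /eta /chord; lra.
have [l nl] := supp c c01.
have nc : \forall s \near c, 0 < s < 1 /\ phi c + l * (s - c) <= phi s.
  case/andP: c01 => cgt0 clt1.
  near=> s; split; last by near: s.
  apply/andP; split; near: s.
    by apply: lt_nbhsr.
  by apply: lt_nbhsl.
(* One step h that is short enough on both sides of c. *)
have /near0_exists_pos[h [/andP[h0 _] [[s01 Hp] [s01' Hm]]]] :
    \forall h \near (0 : R),
      (0 < c + h *: (1 : R) < 1 /\
         phi c + l * (c + h *: (1 : R) - c) <= phi (c + h *: (1 : R))) /\
      (0 < c + h *: (- 1 : R) < 1 /\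
         phi c + l * (c + h *: (-1 : R) - c) <= phi (c + h *: (-1 : R))).
  have n1 := near_line (1 : R^o) nc; have n2 := near_line (-1 : R^o) nc.
  by near=> h; split; near: h.
move: s01 Hp s01' Hm; rewrite /GRing.scale /= mulr1 mulrN1.
move=> /andP[p0 p1] Hp /andP[m0 m1] Hm.
have := maxc (c + h); rewrite in_itv /= (ltW p0) (ltW p1) => /(_ isT).
have := maxc (c - h); rewrite in_itv /= (ltW m0) (ltW m1) => /(_ isT).
rewrite /eta /chord.
have : 0 < e * h ^+ 2 by rewrite mulr_gt0 // exprn_gt0.
nra.
Unshelve. all: by end_near. Qed.

(** * The ray interpolation *)

Section RayInterpolation.
Variables (R : realType) (n : nat) (P : set 'rV[R]_n).
Hypotheses (clP : closed P) (bndP : bounded_set P).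
Variable v : 'rV[R]_n.
Hypotheses (Pv : P v) (v0 : v != 0).

Let ray_coefs_compact : compact (ray_coefs P v).
Proof.
have [M [_ HM]] := bndP.
have nv : 0 < `|v| by rewrite normr_gt0.
apply: (@subclosed_compact _ _ `[0, (`|M| + 1) / `|v|]).
- have -> : ray_coefs P v = [set c | 0 <= c] `&` (fun c => c *: v) @^-1` P by [].
  apply: closedI; first exact: closed_ge.
  apply: preimage_closed => // c _.
  by apply: cvgZ; [exact: cvg_id|exact: cvg_cst].
- exact: segment_compact.
- move=> c [c0 Pc] /=; rewrite in_itv /= c0 /= ler_pdivlMr //.
  have ltM : M < `|M| + 1 by rewrite (le_lt_trans (ler_norm M)) // ltrDl.
  have : `|c *: v| <= `|M| + 1 by exact: HM ltM _ Pc.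
  by rewrite normrZ ger0_norm.
Qed.

Let ray_coefs1 : ray_coefs P v 1.
Proof. by split; rewrite ?scale1r. Qed.

Let cid : {within ray_coefs P v, continuous (id : R -> R)}.
Proof. by apply: continuous_subspaceT => x; exact: cvg_id. Qed.

Lemma vplus_max :
  ray_coefs P v (set_max (ray_coefs P v)) /\ ubound (ray_coefs P v) (set_max (ray_coefs P v)).
Proof.
have [c cS maxc] := compact_EVT_max (ex_intro _ 1 ray_coefs1) ray_coefs_compact cid.
suff [] : (ray_coefs P v `&` ubound (ray_coefs P v)) (set_max (ray_coefs P v)) by [].
apply: xgetPex; exists c; split; first exact: set_mem.
by move=> d /mem_set; exact: maxc.
Qed.

Lemma vminus_min :
  ray_coefs P v (set_min (ray_coefs P v)) /\ lbound (ray_coefs P v) (set_min (ray_coefs P v)).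
Proof.
have [c cS minc] := compact_EVT_min (ex_intro _ 1 ray_coefs1) ray_coefs_compact cid.
suff [] : (ray_coefs P v `&` lbound (ray_coefs P v)) (set_min (ray_coefs P v)) by [].
apply: xgetPex; exists c; split; first exact: set_mem.
by move=> d /mem_set; exact: minc.
Qed.

(** The weight is (c^+ - 1) / (c^+ - c^-) when the extreme ray coefficients c^-
    and c^+ differ; since c^- <= 1 <= c^+, it lies in [0, 1].  When they coincide
    both are 1 and every weight works. *)
Lemma ray_weightP : 0 <= ray_weight P v <= 1 /\
  v = ray_weight P v *: vminus P v + (1 - ray_weight P v) *: vplus P v.
Proof.
rewrite /ray_weight; set A := (X in xget 0 X).
suff : A (xget 0 A) by [].
apply: xgetPex; rewrite /A /= /vminus /vplus.
have [_ /(_ _ ray_coefs1)] := vplus_max; have [_ /(_ _ ray_coefs1)] := vminus_min.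
set p := set_max _; set q := set_min _ => q1 p1.
have [qp|qp] := eqVneq q p.
  exists 0; rewrite lexx ler01; split => //.
  have -> : p = 1 by apply/eqP; rewrite eq_le p1 -qp q1.
  by rewrite !scale1r scale0r add0r subr0 scale1r.
have D0 : 0 < p - q by rewrite subr_gt0 lt_neqAle qp (le_trans q1).
exists ((p - 1) / (p - q)); split.
  rewrite divr_ge0 ?subr_ge0 ?(le_trans q1) //=.
  by rewrite ler_pdivrMr // mul1r lerB.
rewrite !scalerA -scalerDl -[LHS]scale1r; congr (_ *: _).
by field; rewrite gt_eqF.
Qed.

Let vplusP : ray v (vplus P v) /\ P (vplus P v).
Proof. by have [[p0 Pp] _] := vplus_max; split => //; exists (set_max (ray_coefs P v)). Qed.

Let vminusP : ray v (vminus P v) /\ P (vminus P v).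
Proof. by have [[p0 Pp] _] := vminus_min; split => //; exists (set_min (ray_coefs P v)). Qed.

Lemma ray_interpolation_le f : ray_concave P f -> ray_interpolation P f v <= f v.
Proof.
move=> /(_ v Pv) /convex_functionP cf; rewrite /ray_interpolation (negPf v0).
have [w01 wE] := ray_weightP.
have := cf _ _ _ vminusP vplusP w01.
by rewrite -wE; lra.
Qed.

Lemma le_ray_interpolation f h : convex_function P h -> (forall y, P y -> h y <= f y) ->
  h v <= ray_interpolation P f v.
Proof.
move=> /convex_functionP ch hf; rewrite /ray_interpolation (negPf v0).
have [/andP[w0 w1] wE] := ray_weightP.
have w01 : 0 <= ray_weight P v <= 1 by rewrite w0.
have := ch _ _ _ vminusP.2 vplusP.2 w01; rewrite -wE => /le_trans; apply.
by apply: lerD; apply: ler_wpM2l; rewrite ?subr_ge0 ?hf //; case: vminusP vplusP => _ ? [].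
Qed.

(** If v is its own upper endpoint, the equation for the weight forces the
    weight to vanish or the lower endpoint to be v as well. *)
Lemma ray_interpolation_upper f : (forall c, P (c *: v) -> c <= 1) ->
  ray_interpolation P f v = f v.
Proof.
move=> max1; rewrite /ray_interpolation (negPf v0).
have [w01 wE] := ray_weightP.
have p1 : set_max (ray_coefs P v) = 1.
  have [[_ Pp] /(_ _ ray_coefs1) le1] := vplus_max.
  by apply/eqP; rewrite eq_le le1 max1.
move: wE; rewrite /vplus p1 scale1r.
rewrite scalerBl scale1r => /(congr1 (fun x => x - v + ray_weight P v *: v)).
rewrite subrr add0r [v - _]addrC addrA addrK subrK => /esym/eqP.
rewrite -subr_eq0 -scalerBr.
rewrite scaler_eq0 subr_eq0 => /orP[/eqP ->|/eqP ->].
  by rewrite mul0r add0r subr0 mul1r.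
by rewrite -mulrDl addrC subrK mul1r.
Qed.

End RayInterpolation.

(** * Convexity of the homogeneous extension *)

Section BoundaryExtension.
Variables (R : realType) (n m : nat) (a : 'I_m -> 'rV[R]_n) (b : 'I_m -> R).
Local Notation P := (halfspaces a b).
Local Notation gauge := (gauge a b).
Local Notation strictly_inside := (strictly_inside a b).
Hypothesis bndP : bounded_set P.
Variables (f g : 'rV[R]_n -> R) (grad : 'rV[R]_n -> 'rV[R]_n).
Hypothesis diff_f : forall x, P x -> forall e : R, 0 < e ->
  \forall y \near within P (nbhs x),
    `|f y - f x - dotv (grad x) (y - x)| <= e * `|y - x|.
Hypothesis convex_f : forall i, 0 < b i ->
  convex_function (P `&` [set x | dotv (a i) x = b i]) f.
Hypothesis g_le_f : forall x, P x -> g x <= f x.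
Hypothesis hom_g : positively_homogeneous P g.
Hypothesis g_upper : forall x, P x -> gauge x = 1 -> g x = f x.

(** One step t at each precision e is enough: it will be confronted with bounds
    on f (w + t *: (z - w)) - f w, from convexity on a facet or from the ray
    below w, that hold for every t. *)
Lemma diff_quotient w z e : P w -> P z -> 0 < e ->
  exists t, [/\ 0 < t < 1, P (w + t *: (z - w)) &
    `|f (w + t *: (z - w)) - f w - t * dotv (grad w) (z - w)| <=
      t * (e * `|z - w|)].
Proof.
move=> Pw Pz e0.
have := near_line (z - w) (diff_f Pw e0).
move=> /near0_exists_pos[t [t01]].
have Pt : P (w + t *: (z - w)).
  rewrite -lerp_line; apply: halfspaces_convex => //.
  by case/andP: t01 => /ltW -> /ltW ->.
move=> /(_ Pt) H; exists t; split => //.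
move: H; rewrite [w + _]addrC addrK dotvZr normrZ gtr0_norm; last by case/andP: t01.
by rewrite mulrCA.
Qed.

Lemma facet_tangent_le i w v : 0 < b i ->
  P w -> dotv (a i) w = b i -> P v -> dotv (a i) v = b i ->
  dotv (grad w) (v - w) <= f v - f w.
Proof.
move=> bi Pw wi Pv vi; apply: (@le_of_le_addM _ _ _ `|v - w|) => // e e0.
have [t [/andP[t0 t1] Pt]] := diff_quotient Pw Pv e0.
have /convex_functionP cf := convex_f bi.
have t01 : 0 <= t <= 1 by rewrite !ltW.
have := cf v w t (conj Pv vi) (conj Pw wi) t01; rewrite lerp_line => le1.
rewrite ler_norml => /andP[ge1 _].
rewrite -(ler_pM2l t0); lra.
Qed.

(** On the ray below w the function f lies above g, which is linear there, and
    both agree at w; so f decreases inwards no faster than the linear function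
    g does.  The existence of a point c *: w of P with c < 1 is what makes an
    inward step possible. *)
Lemma radial_derivative_le w c : P w -> gauge w = 1 -> 0 < c < 1 -> P (c *: w) ->
  dotv (grad w) w <= f w.
Proof.
move=> Pw gw /andP[c0 c1] Pcw; apply: (@le_of_le_addM _ _ _ `|w|) => // e e0.
have [t [/andP[t0 t1] Pt]] := diff_quotient Pw Pcw e0.
have cwE : c *: w - w = - (1 - c) *: w by rewrite opprB scalerBl scale1r.
have tE : w + t *: (c *: w - w) = (1 - t * (1 - c)) *: w.
  by rewrite cwE scalerA scalerBl scale1r mulrN scaleNr.
move: Pt; rewrite tE cwE => Pt.
have d0 : 0 < 1 - t * (1 - c) by nra.
have := g_le_f Pt; rewrite hom_g // g_upper // dotvZr normrZ normrN.
rewrite [`|1 - c|]gtr0_norm ?subr_gt0 // => le1.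
rewrite ler_norml => /andP[_ ge1].
have tc : 0 < t * (1 - c) by rewrite mulr_gt0 // subr_gt0.
rewrite -(ler_pM2l tc); lra.
Qed.

Definition upper_point v := (gauge v)^-1 *: v.

Lemma upper_pointP v : P v -> v != 0 ->
  [/\ 0 < gauge v, P (upper_point v), gauge (upper_point v) = 1 &
      v = gauge v *: upper_point v].
Proof.
move=> Pv v0; have g0 := gauge_gt0 bndP Pv v0; split => //.
- apply: halfspacesZ => //; last by rewrite mulVf // gt_eqF.
  by rewrite invf_ge1 // gauge_le1.
- by rewrite gaugeZ ?invr_gt0 // mulVf // gt_eqF.
- by rewrite scalerA divff ?scale1r // gt_eqF.
Qed.

(** Homogeneity determines g from the values of f at the upper endpoints. *)
Lemma g_perspective v : P v -> v != 0 -> g v = gauge v * f (upper_point v).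
Proof.
move=> Pv v0; have [g0 Pu gu vE] := upper_pointP Pv v0.
by rewrite {1}vE hom_g -?vE // g_upper.
Qed.

Lemma g_at0 : P 0 -> g 0 = 0.
Proof.
move=> P0; have := hom_g P0 (ltr0Sn R 1); rewrite scaler0 => /(_ P0); lra.
Qed.

Lemma f_continuous : {within P, continuous f}.
Proof.
apply/subspace_continuousP => x Px; apply/cvgrPdist_le => e e0.
have e2 : 0 < e / 2 by rewrite divr_gt0.
have cd : dotv (grad x) y @[y --> within P (nbhs x)] --> dotv (grad x) x.
  by apply: cvg_within_filter; exact: dotv_continuous.
have cid : y @[y --> within P (nbhs x)] --> x by exact: cvg_within.
move/cvgrPdist_le : cd => /(_ _ e2) cd.
move/cvgrPdist_le : cid => /(_ _ e2) cid.
have dx := diff_f Px ltr01.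
near=> y.
have h1 : `|dotv (grad x) x - dotv (grad x) y| <= e / 2 by near: y.
have h2 : `|x - y| <= e / 2 by near: y.
have : `|f y - f x - dotv (grad x) (y - x)| <= 1 * `|y - x| by near: y.
rewrite mul1r [`|y - x|]distrC dotvBr => /le_trans /(_ h2) h3.
move: h1 h3; rewrite !ler_norml => /andP[? ?] /andP[? ?].
by apply/andP; split; rewrite /from_subspace; lra.
Unshelve. all: by end_near. Qed.

Lemma f_bounded : exists C, forall x, P x -> `|f x| <= C.
Proof.
have cP : compact P by apply: bounded_closed_compact => //; exact: halfspaces_closed.
have : bounded_set (f @` P).
  by apply: compact_bounded; apply: continuous_compact => //; exact: f_continuous.
move=> [M [_ HM]]; exists (`|M| + 1) => x Px.
by apply: (HM (`|M| + 1)); [rewrite (le_lt_trans (ler_norm M)) // ltrDl|exists x].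
Qed.

(** Away from the origin this is clear from the perspective formula; at the
    origin f stays bounded and the gauge tends to 0. *)
Lemma g_continuous : {within P, continuous g}.
Proof.
apply/subspace_continuousP => v Pv; rewrite /from_subspace.
have cg : gauge y @[y --> within P (nbhs v)] --> gauge v.
  by apply: cvg_within_filter; exact: gauge_continuous.
have [vE|v0] := eqVneq v 0.
  have [C HC] := f_bounded.
  have gv : g v = 0 by rewrite vE g_at0 // -vE.
  have cC : `|C| * gauge y @[y --> within P (nbhs v)] --> 0.
    have <- : `|C| * gauge v = 0.
      by rewrite vE gauge0 mulr0.
    by apply: cvgM => //; exact: cvg_cst.
  rewrite gv; apply/cvgrPdist_le => e e0.
  move/cvgrPdist_le : cC => /(_ _ e0) cC.
  near=> y.
  have Py : P y by near: y; exact: withinT.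
  have h1 : `|0 - `|C| * gauge y| <= e by near: y.
  rewrite sub0r normrN; have [->|y0] := eqVneq y 0; first by rewrite g_at0 ?normr0 ?ltW // -vE.
  have [gy Pu _ _] := upper_pointP Py y0.
  rewrite g_perspective //; apply: le_trans h1.
  rewrite sub0r normrN !normrM normr_id mulrC ler_wpM2r //.
  exact: (le_trans (HC _ Pu) (ler_norm C)).
have nP : \forall y \near within P (nbhs v), P y by exact: withinT.
have gv := gauge_gt0 bndP Pv v0.
(* A positive gauge persists near v and excludes the origin. *)
have nv0 : \forall y \near within P (nbhs v), y != 0.
  move/cvgr_gt : (cg) => /(_ _ gv) gpos; near=> y.
  have : 0 < gauge y by near: y.
  by apply: contraTneq => ->; rewrite gauge0 ltxx.
have cu : upper_point y @[y --> within P (nbhs v)] --> upper_point v.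
  have cid : y @[y --> within P (nbhs v)] --> v by exact: cvg_within.
  by apply: cvgZ => //; apply: cvgV; rewrite ?gt_eqF.
have cu' : upper_point y @[y --> within P (nbhs v)] --> within P (nbhs (upper_point v)).
  move=> Q /cu nQ.
  have {}nQ : \forall y \near within P (nbhs v), P (upper_point y) -> Q (upper_point y).
    exact: nQ.
  suff : \forall y \near within P (nbhs v), Q (upper_point y) by [].
  near=> y.
  have Py : P y by near: y.
  have y0 : y != 0 by near: y.
  have [_ Pu _ _] := upper_pointP Py y0.
  rewrite /=; have : P (upper_point y) -> Q (upper_point y) by near: y.
  exact.
have [_ Pu _ _] := upper_pointP Pv v0.
have cf := cvg_comp _ _ cu' ((subspace_continuousP _ _).1 f_continuous _ Pu).
rewrite g_perspective //.
apply: cvg_trans (cvgM cg cf).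
have gE : {near within P (nbhs v), (fun y => gauge y * f (upper_point y)) =1 g}.
  by near=> y; rewrite /= g_perspective //; near: y.
exact: (@near_eq_cvg _ _ (within P (nbhs v)) _ _ _ gE).
Unshelve. all: by end_near. Qed.

(** The supporting functional u is the gradient of f at the upper endpoint w of
    z, corrected by a nonnegative multiple of the normal of one facet through w
    so that u(w) = f(w). *)
Lemma g_local_support z : P z -> z != 0 -> gauge z < 1 ->
  exists u, dotv u z = g z /\
    \forall y \near z, P y -> dotv u y <= g y.
Proof.
move=> Pz z0 gz1; have [gz Pw gw zE] := upper_pointP Pz z0.
set w := upper_point z in Pw gw zE.
have [i0 bi0 wi0] : exists2 i, 0 < b i & dotv (a i) w = gauge w * b i.
  by apply: gauge_attained; rewrite gw.
rewrite gw mul1r in wi0.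
have rad : dotv (grad w) w <= f w.
  by apply: (@radial_derivative_le w (gauge z)); rewrite -?zE // gz.
pose c := f w - dotv (grad w) w.
have c0 : 0 <= c by rewrite subr_ge0.
pose u := grad w + (c / b i0) *: a i0.
have uE y : dotv u y = dotv (grad w) y + c * (dotv (a i0) y / b i0).
  by rewrite dotvDl dotvZl -mulrA [_^-1 * _]mulrC.
exists u; split.
  rewrite g_perspective // -/w zE dotvZr -zE uE wi0 divff ?gt_eqF // mulr1.
  by rewrite addrC subrK.
(* Inequality i is tight at the upper endpoint of y iff a_i . y = gauge y * b_i.
   Slackness at z is an open condition, so no slack inequality becomes tight
   near z. *)
have near_active : \forall y \near z, forall i, 0 < b i ->
    dotv (a i) y = gauge y * b i -> dotv (a i) z = gauge z * b i.
  suff H i : \forall y \near z, 0 < b i ->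
      dotv (a i) y = gauge y * b i -> dotv (a i) z = gauge z * b i.
    exact: (@filter_forall _ 'I_m (fun i y => 0 < b i ->
      dotv (a i) y = gauge y * b i -> dotv (a i) z = gauge z * b i) (nbhs z) _ H).
  have [zi|zi] := eqVneq (dotv (a i) z) (gauge z * b i); first by near=> y.
  have [bi|bi] := ltP 0 (b i); last by near=> y.
  have lt : 0 < gauge z * b i - dotv (a i) z.
    by rewrite subr_gt0 lt_neqAle zi dotv_le_gauge.
  have cont : gauge y * b i - dotv (a i) y @[y --> z] --> gauge z * b i - dotv (a i) z.
    have cg : gauge y @[y --> z] --> gauge z by exact: gauge_continuous.
    have cd : dotv (a i) y @[y --> z] --> dotv (a i) z by exact: dotv_continuous.
    exact: (cvgB (cvgM cg (cvg_cst _)) cd).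
  move/cvgr_gt : cont => /(_ _ lt) pos.
  near=> y => _ yi.
  have : 0 < gauge y * b i - dotv (a i) y by near: y.
  by rewrite yi subrr ltxx.
have near_n0 : \forall y \near z, y != 0.
  have /cvgr_gt /(_ _ gz) pos := @gauge_continuous _ _ _ a b z.
  near=> y.
  have : 0 < gauge y by near: y.
  by apply: contraTneq => ->; rewrite gauge0 ltxx.
near=> y => Py.
have y0 : y != 0 by near: y.
have act : forall i, 0 < b i ->
    dotv (a i) y = gauge y * b i -> dotv (a i) z = gauge z * b i by near: y.
have [gy Pv gv yE] := upper_pointP Py y0.
rewrite g_perspective // {1}yE dotvZr ler_pM2l //.
set v := upper_point y in Pv gv yE *.
(* This facet, through v, contains w too, but may differ from facet i0. *)
have [i bi vi] : exists2 i, 0 < b i & dotv (a i) v = gauge v * b i.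
  by apply: gauge_attained; rewrite gv.
rewrite gv mul1r in vi.
have wi : dotv (a i) w = b i.
  by rewrite dotvZr act ?mulKf ?gt_eqF // {1}yE dotvZr vi.
have := facet_tangent_le bi Pw wi Pv vi; rewrite dotvBr uE => tan.
have : c * (dotv (a i0) v / b i0) <= c * 1.
  by apply: ler_wpM2l => //; rewrite ler_pdivrMr // mul1r; exact: Pv.
rewrite /c; lra.
Unshelve. all: by end_near. Qed.

Lemma cvg_g_line (x d : 'rV[R]_n) (s : R) :
  (forall t : R, 0 <= t <= 1 -> P (x + t *: d)) -> 0 <= s <= 1 ->
  g (x + t *: d) @[t --> within `[0, 1] (nbhs s)] --> g (x + s *: d).
Proof.
move=> Pl s01; have cl := @line_cvg R _ x d s.
have /subspace_continuousP/(_ _ (Pl s s01)) := g_continuous.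
rewrite /from_subspace => cg.
apply: (@cvg_comp _ _ _ (fun t => x + t *: d) g _ (within P (nbhs (x + s *: d)))) => //.
move=> Q /cl nQ.
have {}nQ : \forall t \near s, P (x + t *: d) -> Q (x + t *: d) by exact: nQ.
suff : \forall t \near s, `[0, 1]%classic t -> Q (x + t *: d) by [].
near=> t; rewrite /= in_itv /= => t01.
have : P (x + t *: d) -> Q (x + t *: d) by near: t.
by apply; exact: Pl.
Unshelve. all: by end_near. Qed.

Definition convex_between (x y : 'rV[R]_n) := forall t : R, 0 <= t <= 1 ->
  g (t *: x + (1 - t) *: y) <= t * g x + (1 - t) * g y.

Lemma convex_between_avoiding0 x y : P x -> P y ->
  (forall t : R, 0 < t < 1 -> t *: x + (1 - t) *: y != 0 /\
     gauge (t *: x + (1 - t) *: y) < 1) ->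
  convex_between x y.
Proof.
move=> Px Py H t t01.
have Pl s : 0 <= s <= 1 -> P (y + s *: (x - y)).
  by move=> s01; rewrite -lerp_line; exact: halfspaces_convex.
pose phi s := g (y + s *: (x - y)).
have phi1 : phi 1 = g x by rewrite /phi scale1r addrC subrK.
have phi0 : phi 0 = g y by rewrite /phi scale0r addr0.
rewrite lerp_line -phi1 -phi0 -/(phi t).
apply: convex_of_local_support => //.
  apply/subspace_continuousP => s; rewrite /= in_itv /= => s01.
  exact: cvg_g_line.
move=> s s01; have [z0 z1] := H s s01; rewrite lerp_line in z0 z1.
have s01' : 0 <= s <= 1 by case/andP: s01 => /ltW -> /ltW ->.
have [u [uz nu]] := g_local_support (Pl s s01') z0 z1.
exists (dotv u (x - y)).
have nr : \forall r \near s, P (y + r *: (x - y)) ->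
    dotv u (y + r *: (x - y)) <= g (y + r *: (x - y)).
  exact: (@line_cvg R _ y (x - y) s _ nu).
case/andP: s01 => s0 s1.
have n0 : \forall r \near s, 0 < r by apply: lt_nbhsr.
have n1 : \forall r \near s, r < 1 by apply: lt_nbhsl.
near=> r.
have Pr : P (y + r *: (x - y)).
  by apply: Pl; apply/andP; split; apply: ltW; near: r.
have : P (y + r *: (x - y)) ->
  dotv u (y + r *: (x - y)) <= g (y + r *: (x - y)) by near: r.
move=> /(_ Pr); apply: le_trans.
rewrite /phi -uz (dotvDr u y (s *: _)) (dotvDr u y (r *: _)) !dotvZr; lra.
Unshelve. all: by end_near. Qed.

(** Along both moving endpoints and the moving intermediate point, g is
    continuous, so the convexity inequality passes to the limit s -> 0. *)
Lemma convex_between_limit x y x' y' : P x -> P y -> P x' -> P y' ->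
  (forall s : R, 0 < s < 1 ->
     convex_between (x + s *: (x' - x)) (y + s *: (y' - y))) ->
  convex_between x y.
Proof.
move=> Px Py Px' Py' H t t01.
have Pl u v s : P u -> P v -> 0 <= s <= 1 -> P (u + s *: (v - u)).
  by move=> Pu Pv s01; rewrite -lerp_line; exact: halfspaces_convex.
pose z := t *: x + (1 - t) *: y; pose z' := t *: x' + (1 - t) *: y'.
have Pz : P z by exact: halfspaces_convex.
have Pz' : P z' by exact: halfspaces_convex.
have lE s : t *: (x + s *: (x' - x)) + (1 - t) *: (y + s *: (y' - y)) = z + s *: (z' - z).
  by apply/rowP => i; rewrite !mxE; ring.
pose D s := t * g (x + s *: (x' - x)) + (1 - t) * g (y + s *: (y' - y)) - g (z + s *: (z' - z)).
have D0E : D 0 = t * g x + (1 - t) * g y - g z by rewrite /D !scale0r !addr0.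
rewrite -subr_ge0 -/z -D0E leNgt; apply/negP => Dlt.
have c0 : 0 <= (0 : R) <= 1 by rewrite lexx ler01.
have cl u v : P u -> P v -> g (u + s *: (v - u)) @[s --> within `[0, 1] (nbhs (0 : R))]
    --> g (u + (0 : R) *: (v - u)).
  by move=> Pu Pv; apply: cvg_g_line => // s; exact: Pl.
have cD : D s @[s --> within `[0, 1] (nbhs (0 : R))] --> D 0.
  exact: (cvgB (cvgD (cvgM (cvg_cst t) (cl _ _ Px Px'))
    (cvgM (cvg_cst (1 - t)) (cl _ _ Py Py'))) (cl _ _ Pz Pz')).
move/cvgr_lt : cD => /(_ _ Dlt) nD.
have {}nD : \forall s \near (0 : R), `[0, 1]%classic s -> D s < 0 by exact: nD.
have [s [s01 Ds]] := near0_exists_pos nD.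
have {}Ds : D s < 0.
  by apply: Ds; rewrite /= in_itv /=; case/andP: s01 => /ltW -> /ltW ->.
have := H s s01 t t01; rewrite lE -subr_ge0 leNgt.
by rewrite -/(D s) Ds.
Qed.

(** When the origin lies strictly between x and y, so that y is a multiple of x,
    moving y towards a point q off the line through x makes the segment avoid
    the origin. *)
Lemma convex_between_inside x y :
  (x != 0 -> strictly_inside 0 -> exists q, strictly_inside q /\ forall c, q != c *: x) ->
  strictly_inside x -> strictly_inside y -> convex_between x y.
Proof.
move=> escape sx sy.
have [Px Py] := (strictly_insideW sx, strictly_insideW sy).
have inside t : 0 < t < 1 -> strictly_inside (t *: x + (1 - t) *: y).
  by case/andP=> t0 t1; apply: strictly_inside_combination; rewrite // t0 ltW.
have [[t [t01 t0]]|nex] :=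
    pselect (exists t : R, 0 < t < 1 /\ t *: x + (1 - t) *: y = 0); last first.
  apply: convex_between_avoiding0 => // t t01; split; last exact/gauge_lt1/inside.
  by apply/eqP => tE; apply: nex; exists t.
have t1 : 1 - t != 0 by rewrite subr_eq0 gt_eqF //; case/andP: t01.
have yE : y = (- t / (1 - t)) *: x.
  have : (1 - t) *: y = - t *: x by rewrite scaleNr; apply/eqP; rewrite -addr_eq0 addrC t0.
  by move/(congr1 (fun z => (1 - t)^-1 *: z)); rewrite !scalerA mulVf // scale1r mulrC.
have [x0|xN0] := eqVneq x 0.
  move=> r _; rewrite yE x0 !scaler0 addr0.
  have -> : g 0 = 0 by apply: g_at0; rewrite -x0.
  by rewrite !mulr0 addr0.
have [q [sq qNx]] : exists q, strictly_inside q /\ forall c, q != c *: x.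
  by apply: escape => //; rewrite -t0; exact: inside.
have Pq := strictly_insideW sq.
apply: (@convex_between_limit _ _ x q) => // s /andP[s0 s1].
rewrite subrr scaler0 addr0.
have sys : strictly_inside (y + s *: (q - y)).
  by rewrite -lerp_line; apply: strictly_inside_combination; rewrite // s0 ltW.
apply: convex_between_avoiding0 => // [|r /andP[r0 r1]]; first exact: strictly_insideW.
split; last first.
  apply/gauge_lt1/strictly_inside_combination; rewrite ?r0 ?ltW //.
  exact: strictly_insideW.
apply/eqP => rE.
have k0 : (1 - r) * s != 0 by rewrite mulf_neq0 // gt_eqF // subr_gt0.
(* The multiple of x that q would be if the moved segment met the origin,
   obtained by solving r x + (1 - r) (y + s (q - y)) = 0 for q. *)
pose k := - (r + (1 - r) * (1 - s) * (- t / (1 - t))) / ((1 - r) * s).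
have := qNx k; rewrite -subr_eq0 => /eqP; apply.
apply: (scalerI k0); rewrite scaler0 -rE yE.
apply/rowP => i; rewrite !mxE /k; field.
by rewrite t1 subr_eq0 !gt_eqF.
Qed.

Lemma g_convex p : strictly_inside p ->
  (forall x, x != 0 -> strictly_inside 0 -> exists q, strictly_inside q /\ forall c, q != c *: x) ->
  convex_function P g.
Proof.
move=> sp escape; apply/convex_functionP => x y t Px Py.
apply: (@convex_between_limit _ _ p p) => //; try exact: strictly_insideW.
move=> s /andP[s0 s1]; apply: convex_between_inside => [x0|/=|]; first exact: escape;
  by rewrite -lerp_line; apply: strictly_inside_combination; rewrite // s0 ltW.
Qed.

End BoundaryExtension.

(** * The convex envelope *)

(* The hypothesis on n = 1 excludes exactly the case where the claim fails:
   take P = [-1, 1] and f(x) = - x^2, for which g(x) = - |x| and f_vex = -1. *)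
Theorem theorem1 (R : realType) (n : nat) (P : set 'rV[R]_n)
    (f : 'rV[R]_n -> R) :
  polytope P ->
  interior P !=set0 ->
  (n = 1%N -> ~ interior P 0) ->
  continuously_differentiable_on P f ->
  ray_concave P f ->
  convex_over_facets P f ->
  positively_homogeneous P (ray_interpolation P f) ->
  forall x, P x -> convex_envelope P f x = (ray_interpolation P f x)%:E.
Proof.
move=> [bndP exP] [p pint] n1 [grad [_ diff_f]] rayf facetf homg x Px.
have [m [a [b [PE sp irr]]]] := irredundant_halfspaces exP pint.
subst P.
set P := halfspaces a b in bndP pint n1 diff_f rayf facetf homg Px *.
have clP : closed P by exact: halfspaces_closed.
set g := ray_interpolation P f in homg *.
have g_le_f y : P y -> g y <= f y.
  have [->|y0] := eqVneq y 0; first by rewrite /g /ray_interpolation eqxx.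
  by move=> Py; exact: ray_interpolation_le.
have convg : convex_function P g.
  apply: (@g_convex _ _ _ a b bndP f g grad diff_f _ g_le_f homg _ p) => //.
  - move=> i _; apply: facetf; have [q [qi qj]] := irr i.
    exact: (facet_of_halfspace sp qi qj).
  - move=> y Py gy; have y0 : y != 0.
      by apply: contra_eq_neq gy => ->; rewrite gauge0 eq_sym oner_eq0.
    apply: ray_interpolation_upper => // c Pc.
    have [//|c1] := lerP c 1.
    by have := gauge_le1 Pc; rewrite gaugeZ ?(lt_trans ltr01) // gy mulr1 leNgt c1.
  - by move=> y; exact: exists_inside_off_line.
apply/eqP; rewrite eq_le; apply/andP; split.
  apply: ge_ereal_sup => _ [h [convh hf] <-]; rewrite lee_fin.
  have [x0|x0] := eqVneq x 0.
    by rewrite /g /ray_interpolation x0 eqxx; apply: hf; rewrite -x0.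
  exact: le_ray_interpolation.
by apply: ereal_sup_ubound; exists g.
Qed.
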